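(* Let $n,m\ge 1$ be integers, let $G$ be the Cartesian product of the complete graphs $K_{n+1}$ and $K_{m+1}$, and let $P_0$ be the non-lazy simple random walk on $G$ (all transition rates along edges equal to $\frac{1}{n+m}$). Then the normalized curvature flow $(P(t))_{t\ge0}$ with $P(0)=P_0$ converges as $t\to\infty$, and the limit transition rates are as follows: the rate (in both directions) along every horizontal edge, i.e. every edge between $(x,x')$ and $(y,x')$ with $x\neq y$ in $K_{n+1}$ and $x'\in K_{m+1}$, is $$a^\infty=\frac{m+3}{2nm+3n+3m},$$ and the rate (in both directions) along every vertical edge, i.e. every edge between $(x,x')$ and $(x,y')$ with $x\in K_{n+1}$ and $x'\ne y'$ in $K_{m+1}$, is $$b^\infty=\frac{n+3}{2nm+3n+3m}.$$
   Context: Weighting schemes. Let $G=(V,E)$ be a finite simple connected undirected graph. A weighting scheme on $G$ is a matrix $P=(p_{xy})_{x,y\in V}$ of transition rates $p_{xy}\ge 0$, where $p_{xy}>0$ is only allowed if $x=y$ or $\{x,y\}\in E$. It is Markovian if $\sum_{y\in V}p_{xy}=1$ for all $x\in V$, and non-lazy (without laziness) if $p_{xx}=0$ for all $x\in V$. The non-lazy simple random walk is given by $p_{xy}=1/\deg(x)$ for all $\{x,y\}\in E$ and $p_{xx}=0$. Normalized curvature flow. Write $S_1(x)$ for the set of neighbours of $x$ in $G$. For a Markovian weighting scheme $P_0$ without laziness, the normalized curvature flow is the family $(P(t))_{t\ge 0}$ with $P(0)=P_0$, $p_{xx}(t)=0$ for all $x$, $p_{xy}(t)=0$ for distinct non-adjacent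 $x,y$, and, for all $x\in V$ and $y\in S_1(x)$, $$p_{xy}' = p_{xy}\Big(-4p_{yx}-2\sum_{y'\ne y}p_{yy'}+4\sum_{y'}p_{xy'}p_{y'x}+\sum_{y',y''}p_{xy'}p_{y'y''}\Big)+\sum_{y'\neq y}p_{xy'}p_{y'y},$$ where all rates are evaluated at time $t$ and $y',y''$ range over $S_1(x)$. The solution exists and is unique for all $t\ge 0$, and each $P(t)$ is a Markovian weighting scheme without laziness. *)

(* Defs.v *)
From HB Require Import structures.
From mathcomp Require Import all_boot all_order all_algebra.
From mathcomp Require Import all_classical all_reals all_analysis.

Set Implicit Arguments.
Unset Strict Implicit.
Unset Printing Implicit Defensive.

Import Order.TTheory GRing.Theory Num.Theory.
Import numFieldNormedType.Exports.

Local Open Scope classical_set_scope.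
Local Open Scope ring_scope.

(* A finite simple graph is given by an edge relation on a finType. *)
Definition simple_graph (V : finType) (e : rel V) : Prop :=
  symmetric e /\ irreflexive e.

Definition connected_graph (V : finType) (e : rel V) : Prop :=
  forall x y : V, connect e x y.

Definition degree (V : finType) (e : rel V) (x : V) : nat := #|[pred y | e x y]|.

Definition complete_graph (T : finType) : rel T := fun x y => x != y.

Definition cartesian_product (V W : finType) (e : rel V) (f : rel W) :
    rel (V * W)%type :=
  fun p q => (e p.1 q.1 && (p.2 == q.2)) || ((p.1 == q.1) && f p.2 q.2).

Definition weighting_scheme (R : realType) (V : finType) (e : rel V)
    (p : V -> V -> R) : Prop :=
  forall x y, 0 <= p x y /\ (0 < p x y -> x = y \/ e x y).

Definition markovian (R : realType) (V : finType) (p : V -> V -> R) : Prop :=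
  forall x, \sum_(y : V) p x y = 1.

Definition non_lazy (R : realType) (V : finType) (p : V -> V -> R) : Prop :=
  forall x, p x x = 0.

Definition simple_random_walk (R : realType) (V : finType) (e : rel V)
    (x y : V) : R :=
  if e x y then ((degree e x)%:R)^-1 else 0.

Definition flow_rhs (R : realType) (V : finType) (e : rel V)
    (p : V -> V -> R) (x y : V) : R :=
  p x y * (- 4 * p y x
           - 2 * (\sum_(y' | e x y' && (y' != y)) p y y')
           + 4 * (\sum_(y' | e x y') p x y' * p y' x)
           + \sum_(y' | e x y') \sum_(y'' | e x y'') p x y' * p y' y'')
  + \sum_(y' | e x y' && (y' != y)) p x y' * p y' y.

(* The time domain is [0, +oo[: values of P at negative times are irrelevant
   (P is total only for convenience), and the derivative at time 0 is the
   right derivative. *)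
Record normalized_curvature_flow (R : realType) (V : finType) (e : rel V)
    (P0 : V -> V -> R) (P : R -> V -> V -> R) : Prop :=
  NormalizedCurvatureFlow {
    flow_init : forall x y, P 0 x y = P0 x y ;
    flow_non_lazy : forall t : R, 0 <= t -> non_lazy (P t) ;
    flow_non_edge : forall (t : R) (x y : V),
      0 <= t -> x != y -> ~~ e x y -> P t x y = 0 ;
    flow_deriv : forall (t : R) (x y : V), 0 < t -> e x y ->
      is_derive t 1 (fun s : R => P s x y) (flow_rhs e (P t) x y) ;
    flow_deriv0 : forall x y : V, e x y ->
      h^-1 * (P h x y - P 0 x y) @[h --> 0^'+] --> flow_rhs e (P 0) x y
  }.

Definition complete_product (n m : nat) : rel ('I_n.+1 * 'I_m.+1)%type :=
  cartesian_product (@complete_graph 'I_n.+1) (@complete_graph 'I_m.+1).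

(* The graph and the initial datum are in the scope of the definition of the
   flow: the graph is simple and connected, and the simple random walk is a
   Markovian weighting scheme without laziness. *)

Lemma complete_product_simple (n m : nat) : simple_graph (@complete_product n m).
Proof.
split=> [[x x'] [y y']|[x x']]; rewrite /complete_product /cartesian_product.
  by rewrite /complete_graph /= ![y == _]eq_sym ![y' == _]eq_sym.
by rewrite /complete_graph /= !eqxx.
Qed.

Lemma complete_product_connected (n m : nat) :
  connected_graph (@complete_product n m).
Proof.
move=> [x x'] [y y']; apply: (@connect_trans _ _ (y, x')).
  have [->|xy] := eqVneq x y; first exact: connect0.
  by apply: connect1;
    rewrite /complete_product /cartesian_product /complete_graph /= xy eqxx.
have [->|xy] := eqVneq x' y'; first exact: connect0.
by apply: connect1;
  rewrite /complete_product /cartesian_product /complete_graph /= xy !eqxx.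
Qed.

Lemma complete_product_degree (n m : nat) x :
  degree (@complete_product n m) x = (n + m)%N.
Proof.
case: x => x x'; rewrite /degree.
have -> : #|[pred y | complete_product (x, x') y]| =
    #|(finset.setX [set~ x]%SET [set x']%SET
       :|: finset.setX [set x]%SET [set~ x']%SET)%SET|.
  apply: eq_card => -[y y'].
  rewrite !inE /= /complete_product /cartesian_product /complete_graph /=.
  by rewrite ![x == _]eq_sym ![x' == _]eq_sym.
rewrite cardsU !cardsX !cards1 !cardsC1 !card_ord muln1 mul1n /=.
rewrite (_ : (_ :&: _)%SET = finset.set0) ?cards0 ?subn0//.
by apply/setP=> -[y y']; rewrite !inE /=; case: (y == x); case: (y' == x').
Qed.

Lemma simple_random_walk_markovian (R : realType) (V : finType) (e : rel V) :
    simple_graph e -> (forall x, 0 < degree e x)%N ->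
  [/\ weighting_scheme e (@simple_random_walk R V e),
      markovian (@simple_random_walk R V e) &
      non_lazy (@simple_random_walk R V e)].
Proof.
move=> [_ eirr] deg; split.
- move=> x y; rewrite /simple_random_walk; case: ifP => exy.
    by split; [rewrite invr_ge0 ler0n | right].
  by rewrite lexx ltxx.
- move=> x; rewrite /simple_random_walk -big_mkcond /= sumr_const.
  rewrite -[_ *+ _]mulr_natr (_ : #|_| = degree e x).
    by rewrite mulVf// pnatr_eq0 -lt0n.
  by rewrite /degree; apply: eq_card => y; rewrite !inE.
- by move=> x; rewrite /simple_random_walk eirr.
Qed.

(* Main.v *)
(** Among the weights equal to [a] on horizontal and [b] on vertical edges the
    flow reduces to [a' = m a b ((m+3) b - (n+3) a)] with [n a + m b = 1]. With
    the time change [dt = (m + n a / b) ds] the ratio [a / b] solves a logistic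
    equation, so this system has an explicit global solution up to inverting
    [t = t(s)], and it converges to the equilibrium [(n+3) a = (m+3) b]. The
    right-hand side of the flow is polynomial, hence locally Lipschitz, and a
    Gronwall estimate shows that every flow coincides with this solution. *)

Require Import Defs.
From HB Require Import structures.
From mathcomp Require Import all_boot all_order all_algebra.
From mathcomp Require Import all_classical all_reals all_analysis.
From mathcomp Require Import ring lra.

Import Order.TTheory GRing.Theory Num.Theory.
Import numFieldNormedType.Exports.

Local Open Scope classical_set_scope.
Local Open Scope ring_scope.

(** * The two-variable system and its explicit solution *)

Lemma is_derive_continuous {R : realType} {f : R -> R} {x df : R} :
  is_derive x 1 f df -> {for x, continuous f}.
Proof.
by move=> fx; apply/differentiable_continuous/derivable1_diffP/ex_derive.
Qed.

(** Serves to invert the time change [t = t(s)]. By the mean value theorem the lower bound [c] on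
    the slope makes [f] grow at least linearly, so [f] is injective, and onto by the intermediate
    value theorem. *)
Lemma increasing_inverse {R : realType} {f f' : R -> R} {c : R} :
    0 < c -> (forall x : R, is_derive x 1 f (f' x)) -> (forall x, c <= f' x) ->
  exists g : R -> R,
    [/\ cancel f g, forall y : R, is_derive y 1 g (f' (g y))^-1 &
        g y @[y --> +oo] --> +oo].
Proof.
move=> c0 df f'c.
have cf : continuous f by move=> x; exact: is_derive_continuous (df x).
have growth x y : x <= y -> c * (y - x) <= f y - f x.
  move=> xy; have [|z _ ->] := MVT_segment xy (fun z _ => df z).
    exact: continuous_subspaceT.
  by rewrite ler_wpM2r ?subr_ge0.
have f_lt x y : x < y -> f x < f y.
  move=> xy; have := growth _ _ (ltW xy).
  by have := mulr_gt0 c0 (_ : 0 < y - x); rewrite subr_gt0 => /(_ xy); lra.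
have f_inj : injective f.
  by move=> x y fxy; case: (ltgtP x y) => // /f_lt; rewrite fxy ltxx.
have surj y : exists x, f x = y.
  (* Linear growth moves [f] by at least [|y - f 0|] over a length [d] on either side of 0, so the
     values at [- d] and [d] enclose [y]. *)
  pose d := `|y - f 0| / c.
  have d0 : 0 <= d by rewrite divr_ge0// ltW.
  have cd : c * d = `|y - f 0| by rewrite /d mulrC divfK// gt_eqF.
  have := growth _ _ d0; rewrite subr0 cd => h1.
  have := growth (- d) 0; rewrite oppr_le0 sub0r opprK cd => /(_ d0) h2.
  have := ler_norm (y - f 0); have := ler_norm (- (y - f 0)).
  rewrite normrN => h3 h4.
  have [|||x _ <-] := @IVT R f (- d) d y; last by exists x.
  - lra.
  - exact: continuous_subspaceT.
  - by rewrite ge_min le_max; apply/andP; split; apply/orP; [left|right]; lra.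
pose g y := sval (cid (surj y)).
have gK y : f (g y) = y by exact: svalP (cid (surj y)).
have fK : cancel f g by move=> x; apply: f_inj; rewrite gK.
exists g; split => // [y|].
  rewrite -{1}(gK y); apply: is_derive_inverse.
  - by apply: filterE => x; exact: fK.
  - by apply: filterE => x; exact: cf.
  - by rewrite gt_eqF// (lt_le_trans c0).
(* If [g y < A] then [y < f A]; hence [g y] is at least [A] once [y] is at least [f A]. *)
apply/cvgryPge => A; near=> y; rewrite leNgt; apply/negP => /f_lt.
by rewrite gK ltNge => /negP; apply; near: y; exact/nbhs_pinfty_ge/num_real.
Unshelve. all: by end_near. Qed.

(* [q = (m + 3) b / a], which is explicit in the time [s] of the time change. *)
Lemma ratio_flow {R : realType} {n m : R} : 0 < n -> n <= m ->
  exists q : R -> R, [/\ q 0 = m + 3, forall t, 0 < q t,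
    forall t : R, is_derive t 1 q
      (- (m + 3) * (q t - (n + 3)) * q t / (m * q t + n * (m + 3))) &
    q t @[t --> +oo] --> n + 3].
Proof.
move=> n0 nm; pose k := n + 3; pose l := m + 3.
have k0 : 0 < k by rewrite /k; lra.
have l0 : 0 < l by rewrite /l; lra.
(* In the time [s] the ratio solves the linear equation [q' = - l * (q - k)] with [q 0 = l]. The
   assumption [n <= m] keeps [q] positive for negative [s] as well, so [ln q] below makes sense on
   the whole line. *)
pose q s := k + (m - n) * expR (- (l * s)).
have q0 s : 0 < q s.
  by rewrite /q ltr_wpDr// mulr_ge0 ?expR_ge0// subr_ge0.
have q00 : q 0 = l by rewrite /q mulr0 oppr0 expR0 /k /l; ring.
have dq (s : R) : is_derive s 1 q (- l * (q s - k)).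
  rewrite /q; apply: is_derive_eq.
  rewrite /= /GRing.scale /=; ring.
(* The old time [t] as a function of [s]: the primitive of [m + n * l / q] vanishing at 0, obtained
   from [(ln q)' = - l + k * l / q]. Its slope is at least [m]. *)
pose T s := m * s + (n / k) * ((@ln R \o q) s + l * s) - n / k * ln l.
have dT (s : R) : is_derive s 1 T (m + n * l / q s).
  rewrite /T.
  have dln : is_derive s 1 (@ln R \o q) ((q s)^-1 * (- l * (q s - k))).
    exact: (@is_derive1_comp _ _ _ _ _ _ (is_derive1_ln (q0 s))).
  apply: is_derive_eq.
  rewrite /= /GRing.scale /=.
  have := gt_eqF (q0 s); move: (q s) => Q /negbT Q0.
  by field; rewrite Q0 gt_eqF.
have m0 : 0 < m by lra.
have [|g [fK dg gy]] := increasing_inverse m0 dT.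
  by move=> s; rewrite lerDl divr_ge0 ?mulr_ge0// ltW.
have T0 : T 0 = 0.
  by rewrite /T /= q00 !mulr0 add0r addr0 subrr.
exists (q \o g); split => //=.
- by rewrite -T0 fK.
- move=> t; have dqg := @is_derive1_comp _ _ _ _ _ _ (dq (g t)) (dg t).
  apply: (is_derive_eq dqg).
  have := gt_eqF (q0 (g t)).
  have : m * q (g t) + n * l != 0.
    by rewrite gt_eqF// addr_gt0// mulr_gt0.
  rewrite -/k -/l /=; move: (q _) => Q W0 /negbT Q0.
  by field; rewrite W0.
- rewrite -[n + 3]addr0 -[X in _ + X](mulr0 (m - n)).
  apply: cvgD; first exact: cvg_cst.
  apply: cvgMr.
  apply: (cvg_comp (fun t => l * g t) (fun x => expR (- x)) _ (@cvgr_expR R)).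
  exact: gt0_cvgMry.
Qed.

Lemma scalar_flow {R : realType} {n m : R} : 0 < n -> 0 < m ->
  exists a b : R -> R,
    [/\ forall t, n * a t + m * b t = 1,
        a 0 = (n + m)^-1 /\ b 0 = (n + m)^-1,
        forall t : R, is_derive t 1 a
          (m * a t * b t * ((m + 3) * b t - (n + 3) * a t)),
        forall t : R, is_derive t 1 b
          (n * a t * b t * ((n + 3) * a t - (m + 3) * b t)) &
        a t @[t --> +oo] --> (m + 3) / (2 * n * m + 3 * n + 3 * m) /\
        b t @[t --> +oo] --> (n + 3) / (2 * n * m + 3 * n + 3 * m)].
Proof.
(* The system is invariant under exchanging [n] with [m] and [a] with [b], which secures the order
   that [ratio_flow] assumes. *)
wlog nm : n m / n <= m.
  move=> wlog_nm n0 m0; have [/wlog_nm|/ltW/wlog_nm] := leP n m; first exact.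
  case/(_ m0 n0) => b [a [nab [b0 a0] db da [bl al]]]; exists a, b; split=> //.
  - by move=> t; rewrite addrC.
  - by rewrite addrC.
  - move=> t; apply: (is_derive_eq (da t)); ring.
  - move=> t; apply: (is_derive_eq (db t)); ring.
  - rewrite (_ : 2 * n * m + 3 * n + 3 * m = 2 * m * n + 3 * m + 3 * n) //.
    by ring.
move=> n0 m0; have [q [q00 q0 dq ql]] := ratio_flow n0 nm.
pose w t := m * q t + n * (m + 3).
have w0 t : 0 < w t by rewrite addr_gt0 ?mulr_gt0 ?addr_gt0.
have w_neq0 t : w t != 0 by rewrite gt_eqF.
have dw (t : R) : is_derive t 1 w
    (m * (- (m + 3) * (q t - (n + 3)) * q t / w t)).
  by apply: is_derive_eq; rewrite addr0.
have dwV (t : R) := is_deriveV (w_neq0 t) (dw t).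
have lim0 : 2 * n * m + 3 * n + 3 * m != 0.
  by rewrite gt_eqF// !addr_gt0 ?mulr_gt0.
have wl : w t @[t --> +oo] --> 2 * n * m + 3 * n + 3 * m.
  rewrite (_ : _ + _ = m * (n + 3) + n * (m + 3)); last ring.
  by apply: cvgD; [apply: cvgMr|exact: cvg_cst].
have wVl : (w t)^-1 @[t --> +oo] --> (2 * n * m + 3 * n + 3 * m)^-1.
  exact: cvgV.
(* The only [a] and [b] with [n a + m b = 1] and [q = (m + 3) b / a]. *)
exists (fun t => (m + 3) * (w t)^-1), (fun t => q t * (w t)^-1); split.
- by move=> t; rewrite -(divff (w_neq0 t)) /w; field; exact: w_neq0.
- rewrite /w q00; have s0 : n + m != 0 by rewrite gt_eqF ?addr_gt0.
  have m30 : m + 3 != 0 by rewrite gt_eqF ?addr_gt0.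
  by split; field; rewrite s0 mulrC [n * _]mulrC -mulrDr mulf_neq0// addrC.
- move=> t; apply: is_derive_eq => /=; rewrite /GRing.scale /=.
  by have := w_neq0 t; rewrite /w => ?; field.
- move=> t; apply: is_derive_eq => /=; rewrite /GRing.scale /=.
  by have := w_neq0 t; rewrite /w => ?; field.
- by split; [apply: cvgMr|apply: cvgM].
Qed.

(** * Functions that are Lipschitz on bounded sets *)

Definition locally_lipschitz {R : realType} {I : finType} (f : (I -> R) -> R) :=
  forall M : R, exists2 L : R, 0 <= L & forall p q : I -> R,
    (forall i, `|p i| <= M) -> (forall i, `|q i| <= M) ->
    `|f p - f q| <= L * \sum_i `|p i - q i|.

Section LocallyLipschitz.
Context {R : realType} {I : finType}.
Implicit Types f g : (I -> R) -> R.

Lemma locally_lipschitz_cst (c : R) : locally_lipschitz (fun _ : I -> R => c).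
Proof. by move=> M; exists 0 => // p q _ _; rewrite subrr normr0 mul0r. Qed.

Lemma locally_lipschitz_coord (i : I) :
  locally_lipschitz (fun p : I -> R => p i).
Proof.
move=> M; exists 1 => // p q _ _; rewrite mul1r (bigD1 i)//= lerDl.
by rewrite sumr_ge0.
Qed.

Lemma locally_lipschitzD f g : locally_lipschitz f -> locally_lipschitz g ->
  locally_lipschitz (fun p => f p + g p).
Proof.
move=> lf lg M; have [L L0 fL] := lf M; have [K K0 gK] := lg M.
exists (L + K); first exact: addr_ge0.
move=> p q pM qM; rewrite opprD addrACA mulrDl.
by rewrite (le_trans (ler_normD _ _))// lerD ?fL ?gK.
Qed.

Lemma locally_lipschitzN f : locally_lipschitz f ->
  locally_lipschitz (fun p => - f p).
Proof.
move=> lf M; have [L L0 fL] := lf M; exists L => // p q pM qM.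
by rewrite -opprD normrN fL.
Qed.

Lemma locally_lipschitz_bounded {f} : locally_lipschitz f ->
  forall M : R, exists2 B : R, 0 <= B & forall p : I -> R,
    (forall i, `|p i| <= M) -> `|f p| <= B.
Proof.
(* With [|M|] in place of [M] the zero function lies in the cube whatever the sign of [M], so [f p]
   can be compared with the value of [f] at zero. *)
move=> lf M; have [L L0 fL] := lf `|M|.
exists (L * \sum_(i : I) `|M| + `|f (fun=> 0)|).
  by rewrite addr_ge0// mulr_ge0// sumr_ge0.
move=> p pM; have pM' i : `|p i| <= `|M| by rewrite (le_trans (pM i))// ler_norm.
have h0 (i : I) : `|0 : R| <= `|M| by rewrite normr0.
rewrite -[f p](subrK (f (fun=> 0))) (le_trans (ler_normD _ _))// lerD2r.
rewrite (le_trans (fL p (fun=> 0) pM' h0))// ler_wpM2l// ler_sum// => i _.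
by rewrite subr0.
Qed.

Lemma locally_lipschitzM f g : locally_lipschitz f -> locally_lipschitz g ->
  locally_lipschitz (fun p => f p * g p).
Proof.
move=> lf lg M; have [L L0 fL] := lf M; have [K K0 gK] := lg M.
have [A A0 fA] := locally_lipschitz_bounded lf M.
have [B B0 gB] := locally_lipschitz_bounded lg M.
exists (B * L + A * K); first by rewrite addr_ge0 ?mulr_ge0.
move=> p q pM qM.
have -> : f p * g p - f q * g q = g p * (f p - f q) + f q * (g p - g q) by ring.
rewrite mulrDl -!mulrA (le_trans (ler_normD _ _))// !normrM.
by rewrite lerD// ler_pM// ?fL ?gK ?gB ?fA.
Qed.

Lemma locally_lipschitz_sum (J : finType) (P : pred J) (f : J -> (I -> R) -> R) :
  (forall j, locally_lipschitz (f j)) ->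
  locally_lipschitz (fun p => \sum_(j | P j) f j p).
Proof.
move=> lf M; have /choice[L fL] : forall j, exists L : R, 0 <= L /\
    forall p q : I -> R,
    (forall i, `|p i| <= M) -> (forall i, `|q i| <= M) ->
    `|f j p - f j q| <= L * \sum_i `|p i - q i|.
  by move=> j; have [L] := lf j M; exists L.
exists (\sum_(j | P j) L j); first by apply: sumr_ge0 => j _; have [] := fL j.
move=> p q pM qM; rewrite -sumrB mulr_suml (le_trans (ler_norm_sum _ _ _))//.
by apply: ler_sum => j _; have [_] := fL j; apply.
Qed.

End LocallyLipschitz.

(** * Uniqueness for autonomous differential equations on [[0, +oo[] *)

Definition ode_solution {R : realType} {I : finType} (F : I -> (I -> R) -> R)
    (p : R -> I -> R) :=
  [/\ forall i, p t i @[t --> 0^'+] --> p 0 i &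
      forall (t : R) i, 0 < t -> is_derive t 1 (fun s : R => p s i) (F i (p t))].

Section Uniqueness.
Context {R : realType} {I : finType}.

Lemma within_continuous_ge0 {f df : R -> R} :
  f t @[t --> 0^'+] --> f 0 -> (forall t : R, 0 < t -> is_derive t 1 f (df t)) ->
  forall t : R, 0 < t -> {within `[0, t], continuous f}.
Proof.
move=> f0 fdf t t0; apply/continuous_within_itvP => //; split => //.
  move=> x; rewrite in_itv/= => /andP[x0 _].
  exact: is_derive_continuous (fdf _ x0).
exact/cvg_at_left_filter/(is_derive_continuous (fdf _ t0)).
Qed.

(** The integrating factor [expR (- C * s)] turns the inequality into a nonpositive derivative of
    the product, to which the mean value theorem on [[0, t]] applies. *)
Lemma gronwall0 {f df : R -> R} {C : R} :
  f t @[t --> 0^'+] --> f 0 -> (forall t : R, 0 < t -> is_derive t 1 f (df t)) ->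
  forall t : R, 0 < t -> (forall s : R, 0 < s < t -> df s <= C * f s) ->
  f 0 <= 0 -> f t <= 0.
Proof.
move=> f0 fdf t t0 fC f0le.
have de (s : R) : is_derive s 1 (fun s => expR (- C * s)) (- C * expR (- C * s)).
  by apply: is_derive_eq; rewrite /GRing.scale /=; ring.
pose g := f * (fun s => expR (- C * s)).
have dg (s : R) : 0 < s -> is_derive s 1 g ((df s - C * f s) * expR (- C * s)).
  move=> s0; have dfs := fdf _ s0; apply: is_derive_eq.
  rewrite /GRing.scale /=; ring.
have cg : g s @[s --> 0^'+] --> g 0.
  by apply: cvgM => //; exact/cvg_at_right_filter/(is_derive_continuous (de 0)).
have dg' (x : R) : x \in `]0, t[ ->
    is_derive x 1 g ((df x - C * f x) * expR (- C * x)).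
  by rewrite in_itv/= => /andP[x0 _]; exact: dg.
have [x x0t] := MVT t0 dg' (within_continuous_ge0 cg dg _ t0).
move: x0t; rewrite in_itv/= => x0t.
rewrite subr0 => gE.
have : g t - g 0 <= 0.
  rewrite gE; apply: mulr_le0_ge0; last exact: ltW.
  by apply: mulr_le0_ge0; [rewrite subr_le0 fC|exact: expR_ge0].
rewrite /g !fctE mulr0 expR0 mulr1 => gt.
rewrite -(pmulr_lle0 _ (expR_gt0 (- C * t))); lra.
Qed.

(** Each coordinate is continuous on the compact interval, and the index set is finite. *)
Lemma ode_solution_bounded {F : I -> (I -> R) -> R} {p} :
  ode_solution F p -> forall T : R, 0 < T ->
  exists M : R, forall (t : R) i, 0 <= t <= T -> `|p t i| <= M.
Proof.
move=> [p0 dp] T T0.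
have /choice[B pB] : forall i, exists B : R,
    forall t : R, 0 <= t <= T -> `|p t i| <= B.
  move=> i; have cp := within_continuous_ge0 (p0 i) (fun t => dp t i) _ T0.
  have cnp : {within `[0, T], continuous (fun t => `|p t i|)}.
    by move=> x; apply: cvg_norm; exact: cp.
  have [c _ pc] := EVT_max (ltW T0) cnp.
  by exists `|p c i| => t tT; apply: pc; rewrite in_itv.
exists (\sum_i `|B i|) => t i tT.
rewrite (le_trans (pB i t tT))// (bigD1 i)//= (le_trans (ler_norm _))//.
by rewrite lerDl sumr_ge0.
Qed.

(** Cauchy-Schwarz against a constant vector, from the bound of each [|d i| * |d j|] by the mean of
    the squares. It converts the sum of absolute values in the Lipschitz bound into the squared
    distance used for Gronwall. *)
Lemma sum_normM_le (d : I -> R) :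
  (\sum_i `|d i|) * (\sum_i `|d i|) <= #|I|%:R * \sum_i d i ^+ 2.
Proof.
rewrite mulr_suml; under eq_bigr do rewrite mulr_sumr.
have -> : #|I|%:R * \sum_i d i ^+ 2 =
    \sum_(i : I) \sum_(j : I) (d i ^+ 2 + d j ^+ 2) / 2.
  under [RHS]eq_bigr do rewrite -mulr_suml big_split/= sumr_const.
  rewrite -[RHS]mulr_suml big_split/= sumr_const sumrMnl -mulr_natl.
  by field.
apply: ler_sum => i _; apply: ler_sum => j _.
have := sqr_ge0 (`|d i| - `|d j|).
rewrite -[d i ^+ 2]real_normK ?num_real// -[d j ^+ 2]real_normK ?num_real//.
move: `|d i| `|d j| => x y; lra.
Qed.

Lemma is_derive_big (h : I -> R -> R) (dh : I -> R) (t : R) :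
  (forall i, is_derive t 1 (h i) (dh i)) ->
  is_derive t 1 (fun s => \sum_i h i s) (\sum_i dh i).
Proof.
move=> dhi; rewrite (_ : (fun _ => _) = \sum_i h i); last first.
  by apply/funext => s; rewrite fct_sumE.
by elim/big_ind2 : _ => // *; [exact: is_derive_cst|exact: is_deriveD].
Qed.

Lemma ode_solution_unique {F : I -> (I -> R) -> R} {p q} :
  (forall i, locally_lipschitz (F i)) ->
  ode_solution F p -> ode_solution F q -> p 0 = q 0 ->
  forall (t : R) i, 0 <= t -> p t i = q t i.
Proof.
move=> lF sp sq pq0 t i; rewrite le_eqVlt => /predU1P[<-|t0].
  by rewrite pq0.
have [Mp pM] := ode_solution_bounded sp _ t0.
have [Mq qM] := ode_solution_bounded sq _ t0.
pose M := Num.max Mp Mq.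
have /choice[L FL] : forall j, exists L : R, 0 <= L /\
    forall p q : I -> R,
    (forall i, `|p i| <= M) -> (forall i, `|q i| <= M) ->
    `|F j p - F j q| <= L * \sum_i `|p i - q i|.
  by move=> j; have [L] := lF j M; exists L.
pose d t j := p t j - q t j.
(* The squared Euclidean distance is differentiable, unlike the sum of absolute values. With [K] the
   sum of the Lipschitz constants it satisfies [D' <= 2 * K * #|I| * D]. *)
pose D t := \sum_j d t j ^+ 2.
have {sp}[p0 dp] := sp; have {sq}[q0 dq] := sq.
have Dt0 : D t <= 0.
  pose K := \sum_j L j.
  pose dD s := \sum_j 2 * d s j * (F j (p s) - F j (q s)).
  have dDD (s : R) : 0 < s -> is_derive s 1 D (dD s).
    move=> s0; apply: is_derive_big => j.
    have dps := dp s j s0; have dqs := dq s j s0.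
    rewrite /d; apply: is_derive_eq.
    rewrite /GRing.scale /=; ring.
  apply: (@gronwall0 _ dD (2 * K * #|I|%:R) _ dDD _ t0).
  - rewrite /D; apply: cvg_big => [|j _]; first exact: add_continuous.
    rewrite /d.
    by rewrite !expr2; apply: cvgM; apply: cvgB.
  - move=> s /andP[s0 st].
    have sT : 0 <= s <= t by rewrite !ltW.
    have pM' k : `|p s k| <= M by rewrite le_max pM.
    have qM' k : `|q s k| <= M by rewrite le_max qM ?orbT.
    have K0 : 0 <= K by apply: sumr_ge0 => j _; have [] := FL j.
    have S0 : 0 <= \sum_k `|d s k| by rewrite sumr_ge0.
    apply: (@le_trans _ _ (2 * K * ((\sum_k `|d s k|) * (\sum_k `|d s k|)))).
      rewrite [in leRHS]mulr_suml mulr_sumr; apply: ler_sum => j _.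
      rewrite -!mulrA ler_pM2l// (le_trans (ler_norm _))// normrM mulrCA.
      apply: ler_wpM2l => //; have [Lj /(_ _ _ pM' qM')/le_trans] := FL j; apply.
      rewrite ler_wpM2r// /K (bigD1 j)//= lerDl sumr_ge0// => k _.
      by have [] := FL k.
    by rewrite -[leRHS]mulrA ler_wpM2l ?mulr_ge0// sum_normM_le.
  - rewrite /D big1// => j _; rewrite /d pq0 subrr expr0n//.
have D0 : D t == 0 by rewrite eq_le Dt0 sumr_ge0// => j _; exact: sqr_ge0.
have := D0; rewrite psumr_eq0; last by move=> j _; exact: sqr_ge0.
by move=> /allP/(_ i (mem_index_enum _)); rewrite sqrf_eq0 subr_eq0 => /eqP.
Qed.

End Uniqueness.

(** * The curvature flow as a differential equation on all pairs of vertices *)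

Lemma right_derivative_cvg {R : realType} {f : R -> R} {l : R} :
  h^-1 * (f h - f 0) @[h --> 0^'+] --> l -> f h @[h --> 0^'+] --> f 0.
Proof.
move=> fl.
have : h * (h^-1 * (f h - f 0)) + f 0 @[h --> 0^'+] --> 0 * l + f 0.
  apply: cvgD; last exact: cvg_cst.
  by apply: cvgM fl; apply: cvg_at_right_filter; exact: cvg_id.
rewrite mul0r add0r; apply: cvg_trans; apply: near_eq_cvg; near=> h.
by rewrite mulVKf ?subrK// gt_eqF//; near: h; exact: nbhs_right_gt.
Unshelve. all: by end_near. Qed.

(** The field vanishes off the edges because the flow keeps those rates, diagonal included, equal to
    0. Thus a flow solves one equation on the full space of matrices. *)
Definition flow_field {R : realType} {V : finType} (e : rel V) (i : V * V)
    (p : V * V -> R) : R :=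
  if e i.1 i.2 then flow_rhs e (fun x y => p (x, y)) i.1 i.2 else 0.

Lemma flow_field_lipschitz {R : realType} {V : finType} (e : rel V) i :
  locally_lipschitz (@flow_field R V e i).
Proof.
case: i => x y; rewrite /flow_field /=; case: (e x y); last first.
  exact: locally_lipschitz_cst.
by rewrite /flow_rhs;
  do ?[exact: locally_lipschitz_cst|exact: locally_lipschitz_coord
      |apply: locally_lipschitzD|apply: locally_lipschitzN
      |apply: locally_lipschitzM|apply: locally_lipschitz_sum => ?].
Qed.

Lemma flow_non_edge0 {R : realType} {V : finType} {e : rel V} {P0 P} :
    @normalized_curvature_flow R V e P0 P ->
  forall (t : R) x y, 0 <= t -> ~~ e x y -> P t x y = 0.
Proof.
move=> flP t x y t0 exy; have [<-|xy] := eqVneq x y.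
  exact: (flow_non_lazy flP t0).
exact: (flow_non_edge flP t0 xy exy).
Qed.

Lemma flow_ode_solution {R : realType} {V : finType} {e : rel V} {P0 P} :
    @normalized_curvature_flow R V e P0 P ->
  ode_solution (flow_field e) (fun t i => P t i.1 i.2).
Proof.
move=> flP; split => [[x y]/=|t [x y]/= t0].
  have [exy|exy] := boolP (e x y).
    have dP := flow_deriv0 flP exy.
    exact: (right_derivative_cvg (f := fun t => P t x y) dP).
  rewrite (flow_non_edge0 flP)//; apply: cvg_near_cst; near=> t.
  by rewrite (flow_non_edge0 flP)//; near: t; exact: nbhs_right_ge.
rewrite /flow_field /=; have [exy|exy] := boolP (e x y).
  exact: (flow_deriv flP t0 exy).
(* The rate is known to be 0 at nonnegative times only; since [t > 0], this covers a neighbourhood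
   of [t]. *)
have d0 := @is_derive_cst R R R 0 t 1.
apply: near_eq_is_derive d0.
near=> s; rewrite (flow_non_edge0 flP)//; apply: ltW; near: s; exact: lt_nbhsr.
Unshelve. all: by end_near. Qed.

Lemma normalized_curvature_flow_unique {R : realType} {V : finType} {e : rel V}
    {P0 P Q} :
    @normalized_curvature_flow R V e P0 P ->
    @normalized_curvature_flow R V e P0 Q ->
  forall (t : R) x y, 0 <= t -> P t x y = Q t x y.
Proof.
move=> flP flQ t x y t0.
apply: (ode_solution_unique (flow_field_lipschitz e) (flow_ode_solution flP)
  (flow_ode_solution flQ) _ t (x, y) t0).
by apply/funext => i; rewrite (flow_init flP) (flow_init flQ).
Qed.

(** * Two-parameter weights on the product graph *)

Definition product_weights {R : realType} {n m : nat} (a b : R)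
    (u v : 'I_n.+1 * 'I_m.+1) : R :=
  if u.2 == v.2 then (if u.1 == v.1 then 0 else a)
  else (if u.1 == v.1 then b else 0).

Section ProductWeights.
Context {R : realType} {n m : nat}.
Implicit Types (a b : R) (u v : 'I_n.+1 * 'I_m.+1).

Lemma complete_productE u v :
  complete_product u v = (u.1 != v.1) (+) (u.2 != v.2).
Proof.
rewrite /complete_product /cartesian_product /complete_graph /=.
by case: eqP; case: eqP.
Qed.

Lemma sum_complete_product u (F : 'I_n.+1 * 'I_m.+1 -> R) :
  \sum_(v | complete_product u v) F v =
  \sum_(i | i != u.1) F (i, u.2) + \sum_(j | j != u.2) F (u.1, j).
Proof.
transitivity (\sum_i \sum_j if complete_product u (i, j) then F (i, j) else 0).
  by rewrite pair_bigA big_mkcond; apply: eq_bigr; case.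
rewrite (bigD1 u.1)//= addrC; congr (_ + _).
  apply: eq_bigr => i iu; rewrite (bigD1 u.2)//= big1 ?addr0.
    by rewrite complete_productE /= eqxx eq_sym iu.
  by move=> j ju; rewrite complete_productE /= eq_sym iu eq_sym ju.
rewrite -big_mkcond; apply: eq_bigl => j.
by rewrite complete_productE /= eqxx eq_sym.
Qed.

Lemma sum_neq k (x : 'I_k.+1) (c : R) : \sum_(i | i != x) c = k%:R * c.
Proof.
by rewrite sumr_const mulr_natl; congr (_ *+ _); rewrite cardC1 card_ord.
Qed.

Lemma sum_neq_if_same k (x : 'I_k.+1) (c d : R) :
  \sum_(i | i != x) (if x == i then c else d) = k%:R * d.
Proof.
by rewrite -(sum_neq _ x); apply: eq_bigr => i; rewrite eq_sym => /negbTE ->.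
Qed.

Lemma sum_neq_if k (x y : 'I_k.+1) (c d : R) : y != x ->
  \sum_(i | i != x) (if y == i then c else d) = k%:R * d + (c - d).
Proof.
move=> yx; rewrite -(sum_neq _ x) (bigD1 y)//= [in RHS](bigD1 y)//= eqxx.
rewrite [RHS]addrC addrA subrK; congr (_ + _).
by apply: eq_bigr => i /andP[_ iy]; rewrite eq_sym (negbTE iy).
Qed.

Lemma sum_product_weights a b u v : complete_product u v ->
  \sum_(w | complete_product u w) product_weights a b v w =
  if u.2 == v.2 then n%:R * a - a else m%:R * b - b.
Proof.
case: u v => [i k] [j l]; rewrite complete_productE sum_complete_product /=.
rewrite /product_weights /=.
have [<-|kl] := eqVneq k l; have [<-|ij] := eqVneq i j => //= _.
- rewrite [X in _ + X]big1 ?addr0.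
    by rewrite sum_neq_if ?sub0r// eq_sym.
  by move=> h hk; rewrite eq_sym (negbTE hk).
- rewrite [X in X + _]big1 ?add0r.
    by rewrite sum_neq_if ?sub0r// eq_sym.
  by move=> h hi; rewrite eq_sym (negbTE hi).
Qed.

(** Two-step rates. Between distinct vertices of one row or column, an intermediate vertex must be
    another vertex of that row or column, leaving [n - 1] or [m - 1] paths. *)
Lemma product_weights_square a b u v : u = v \/ complete_product u v ->
  \sum_(w | complete_product u w)
    product_weights a b u w * product_weights a b w v =
  if u == v then n%:R * a ^+ 2 + m%:R * b ^+ 2 else
  if u.2 == v.2 then n%:R * a ^+ 2 - a ^+ 2 else m%:R * b ^+ 2 - b ^+ 2.
Proof.
case: u v => [i k] [j l] uv; rewrite sum_complete_product /=.
rewrite (eq_bigr (fun h => a * (if k == l then if j == h then 0 else a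
    else if j == h then b else 0))); last first.
  move=> h hi.
  by rewrite /product_weights /= eqxx eq_sym (negbTE hi) [j == h]eq_sym.
rewrite -mulr_sumr [X in _ + X](eq_bigr (fun h => b * (if i == j then
    if l == h then 0 else b else if l == h then a else 0))); last first.
  move=> h hk.
  rewrite /product_weights /= eq_sym (negbTE hk) eqxx [l == h]eq_sym.
  by case: eqP; case: eqP.
rewrite -mulr_sumr xpair_eqE.
(* Excludes the diagonal position, where both coordinates differ. *)
have : ~~ ((i != j) && (k != l)).
  case: uv => [[-> _]|]; first by rewrite eqxx.
  by rewrite complete_productE /=; do 2 case: eqP.
have [<-|ij] := eqVneq i j; have [<-|kl] := eqVneq k l => //= _.
- rewrite !sum_neq_if_same; ring.
- rewrite sum_neq_if_same sum_neq_if 1?eq_sym//; ring.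
- rewrite sum_neq_if_same sum_neq_if 1?eq_sym//; ring.
Qed.

(** In [q], the return term gives [4 n a^2] and the double sum [n (n - 1) a^2], and likewise for
    [b]. On a horizontal edge the other terms contribute the factor [- 4 a - 2 (n - 1) a + (n - 1) a
    = - (n + 3) a]. *)
Lemma flow_rhs_product_weights a b u v : complete_product u v ->
  let q := n%:R * (n%:R + 3) * a ^+ 2 + m%:R * (m%:R + 3) * b ^+ 2 in
  flow_rhs (@complete_product n m) (product_weights a b) u v =
  if u.2 == v.2 then a * (q - (n%:R + 3) * a) else b * (q - (m%:R + 3) * b).
Proof.
move=> uv q; rewrite /flow_rhs.
have drop (F : _ -> R) : F v = 0 ->
    \sum_(w | complete_product u w && (w != v)) F w =
    \sum_(w | complete_product u w) F w.
  move=> Fv; rewrite big_mkcondr; apply: eq_bigr => w _.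
  by case: eqP => [->|].
have pvv : product_weights a b v v = 0 by rewrite /product_weights !eqxx.
rewrite !drop ?pvv ?mulr0// sum_product_weights//.
rewrite !product_weights_square; [|by right|by left].
(* Summing over the intermediate vertex first turns the double sum into two-step rates from [u] to
   its neighbours. *)
rewrite exchange_big/= (eq_bigr (fun w => if u.2 == w.2
    then n%:R * a ^+ 2 - a ^+ 2 else m%:R * b ^+ 2 - b ^+ 2)); last first.
  move=> w uw; rewrite product_weights_square; last by right.
  by case: eqP uw => // <-; rewrite complete_productE !eqxx.
rewrite sum_complete_product/= (eq_bigr (fun=> n%:R * a ^+ 2 - a ^+ 2)); last first.
  by move=> i _; rewrite eqxx.
rewrite [X in _ * (_ + (_ + X)) + _](eq_bigr (fun=> m%:R * b ^+ 2 - b ^+ 2)); last first.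
  by move=> j; rewrite eq_sym => /negbTE ->.
rewrite !sum_neq eqxx; have uDv : u == v = false.
  by apply/eqP => uv'; move: uv; rewrite uv' complete_productE !eqxx.
rewrite uDv /product_weights [v.2 == _]eq_sym [v.1 == _]eq_sym.
move: uv; rewrite complete_productE.
by case: (u.2 == v.2); case: (u.1 == v.1) => //= _; rewrite /q; ring.
Qed.

End ProductWeights.

(** * The explicit flow on the product and its limit *)

Lemma is_derive_right_cvg {R : realType} {f : R -> R} {l : R} :
  is_derive (0 : R) 1 f l -> h^-1 * (f h - f 0) @[h --> 0^'+] --> l.
Proof.
case=> df <-; apply: cvg_dnbhs_at_right; apply: cvg_trans (df).
by apply: near_eq_cvg; near=> h; rewrite /GRing.scale/= mulr1 addr0.
Unshelve. all: by end_near. Qed.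

Lemma product_flow {R : realType} {n m : nat} {a b : R -> R} :
    (forall t, n%:R * a t + m%:R * b t = 1) ->
    a 0 = (n%:R + m%:R)^-1 -> b 0 = (n%:R + m%:R)^-1 ->
    (forall t : R, is_derive t 1 a
      (m%:R * a t * b t * ((m%:R + 3) * b t - (n%:R + 3) * a t))) ->
    (forall t : R, is_derive t 1 b
      (n%:R * a t * b t * ((n%:R + 3) * a t - (m%:R + 3) * b t))) ->
  normalized_curvature_flow (@complete_product n m)
    (@simple_random_walk R _ (@complete_product n m))
    (fun t => product_weights (a t) (b t)).
Proof.
move=> nab a0 b0 da db.
have dP (t : R) u v : complete_product u v ->
    is_derive t 1 (fun s => product_weights (a s) (b s) u v)
      (flow_rhs (@complete_product n m) (product_weights (a t) (b t)) u v).
  move=> uv; rewrite flow_rhs_product_weights// /product_weights.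
  move: uv; rewrite complete_productE.
  case: (u.2 == v.2); case: (u.1 == v.1) => //= _.
    apply: (is_derive_eq (da t)).
    (* Multiplying the linear term by [n a + m b = 1] makes the bracket homogeneous of degree 2; the
       [a^2] terms cancel and [m b] factors out. *)
    transitivity (a t * (n%:R * (n%:R + 3) * a t ^+ 2 +
      m%:R * (m%:R + 3) * b t ^+ 2 -
      (n%:R + 3) * a t * (n%:R * a t + m%:R * b t))); first ring.
    by rewrite nab mulr1.
  apply: (is_derive_eq (db t)).
  transitivity (b t * (n%:R * (n%:R + 3) * a t ^+ 2 +
    m%:R * (m%:R + 3) * b t ^+ 2 -
    (m%:R + 3) * b t * (n%:R * a t + m%:R * b t))); first ring.
  by rewrite nab mulr1.
split.
- move=> u v; rewrite /simple_random_walk complete_product_degree natrD.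
  rewrite /product_weights complete_productE a0 b0.
  by case: (u.2 == v.2); case: (u.1 == v.1).
- by move=> t _ u; rewrite /product_weights !eqxx.
- move=> t [i k] [j l] _; rewrite complete_productE /product_weights xpair_eqE/=.
  by do 2 case: eqP.
- by move=> t u v _; exact: dP.
- by move=> u v uv; have d0 := dP 0 u v uv; exact: (is_derive_right_cvg d0).
Qed.

Theorem theorem2p11 (R : realType) (n m : nat) (hn : (1 <= n)%N) (hm : (1 <= m)%N) :
  let G := @complete_product n m in
  let P0 := @simple_random_walk R ('I_n.+1 * 'I_m.+1)%type G in
  (exists P, normalized_curvature_flow G P0 P) /\
  (forall P, normalized_curvature_flow G P0 P ->
    exists Pinf : 'I_n.+1 * 'I_m.+1 -> 'I_n.+1 * 'I_m.+1 -> R,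
      [/\ forall u v, P t u v @[t --> +oo] --> Pinf u v,
          forall (x y : 'I_n.+1) (x' : 'I_m.+1), x != y ->
            Pinf (x, x') (y, x') =
              (m + 3)%:R / (2 * n * m + 3 * n + 3 * m)%:R
        & forall (x : 'I_n.+1) (x' y' : 'I_m.+1), x' != y' ->
            Pinf (x, x') (x, y') =
              (n + 3)%:R / (2 * n * m + 3 * n + 3 * m)%:R]).
Proof.
move=> G P0; have n0 : 0 < n%:R :> R by rewrite ltr0n.
have m0 : 0 < m%:R :> R by rewrite ltr0n.
have [a [b [nab [a0 b0] da db [al bl]]]] := scalar_flow n0 m0.
have flQ := product_flow nab a0 b0 da db.
split=> [|P flP]; first by exists (fun t => product_weights (a t) (b t)).
exists (product_weights ((m + 3)%:R / (2 * n * m + 3 * n + 3 * m)%:R)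
  ((n + 3)%:R / (2 * n * m + 3 * n + 3 * m)%:R)); split.
- move=> u v.
  rewrite !(natrD _ _ 3).
  rewrite (_ : (2 * n * m + 3 * n + 3 * m)%:R =
    2 * n%:R * m%:R + 3 * n%:R + 3 * m%:R); last by ring.
  have : product_weights (a t) (b t) u v @[t --> +oo] -->
      product_weights ((m%:R + 3) / (2 * n%:R * m%:R + 3 * n%:R + 3 * m%:R))
        ((n%:R + 3) / (2 * n%:R * m%:R + 3 * n%:R + 3 * m%:R)) u v.
    rewrite /product_weights.
    by case: (u.2 == v.2); case: (u.1 == v.1) => //; exact: cvg_cst.
  (* An arbitrary flow agrees with the explicit one at all nonnegative times, hence near [+oo]. *)
  apply: cvg_trans; apply: near_eq_cvg; near=> t.
  by rewrite (normalized_curvature_flow_unique flP flQ).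
- by move=> x y x' /negbTE xy; rewrite /product_weights/= eqxx xy.
- by move=> x x' y' /negbTE xy; rewrite /product_weights/= eqxx xy.
Unshelve. all: by end_near. Qed.
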